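(* (a) Let $p$ be an odd prime and $k$ an integer with $p>k\geq 2$. Let $T=\overline{G}_k$, acting faithfully by right multiplication on the set $\Omega=\{(1,\mathbf{v}) : \mathbf{v}\in\mathbb{F}_p^k\}$ of size $p^k$, and let $\mathcal{I}=(\tau_{\mathbf{w}_0}\tau_{\mathbf{w}_0}^{-1},\tau_{\mathbf{w}_1}\tau_{\mathbf{w}_0}^{-1},\ldots,\tau_{\mathbf{w}_{p-1}}\tau_{\mathbf{w}_0}^{-1})$, a $p$-tuple of automorphisms of $T$, each viewed as a permutation representation of $T$ on $\Omega$. Then the twisted permutation code $C(T,\mathcal{I})$ satisfies $\delta_{tw}>\delta_{rep}$; precisely, $\delta_{tw}=p^{k+1}-p$ and $\delta_{tw}-\delta_{rep}=p^2-p$. (b) Let $n\geq 1$ be an integer, $\mathbb{F}$ the field of order $2^n$, $V=\mathbb{F}^4$ equipped with a non-degenerate symplectic (alternating) form, and $T=\mathrm{Sp}(4,2^n)$ its isometry group, acting faithfully on the set $\mathrm{PG}(V)$ of $2^{3n}+2^{2n}+2^n+1$ one-dimensional subspaces of $V$. Let $\tau$ be an outer automorphism of $T$ under which the image of every transvection fixes (setwise) exactly $2^n+1$ elements of $\mathrm{PG}(V)$, let $\iota$ be the identity automorphism of $T$, and let $\mathcal{I}=(\iota,\tau)$, each entry viewed as a permutation representation of $T$ on $\mathrm{PG}(V)$. Then the twisted permutation code $C(T,\mathcal{I})$ satisfies $\delta_{tw}>\delta_{rep}$; precisely, $\delta_{tw}=2^{3n+1}+2^{2n}$ and $\delta_{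tw}-\delta_{rep}=2^{2n}$.
   Context: Codes. For a finite set $Q$ of size $q$ (with a fixed ordering $x_1,\ldots,x_q$ of its elements) and a positive integer $m$, the Hamming distance between two $m$-tuples over $Q$ is the number of entries in which they differ. A code of length $m$ over $Q$ is a set of $m$-tuples over $Q$, and the minimum distance $\delta(C)$ of a code $C$ with at least two codewords is the smallest Hamming distance between distinct codewords. Let $T$ be a group and $\rho:T\to\mathrm{Sym}(Q)$ a permutation representation. For $t\in T$ put $\alpha(t,\rho)=(x_1^{\rho(t)},\ldots,x_q^{\rho(t)})\in Q^q$, and let $C(T,\rho)=\{\alpha(t,\rho): t\in T\}$. For an ordered list $\mathcal{I}=(\rho_1,\ldots,\rho_r)$ of permutation representations of $T$ on $Q$ (repetitions allowed), put $\alpha(t,\mathcal{I})=(\alpha(t,\rho_1),\ldots,\alpha(t,\rho_r))\in Q^{rq}$. The twisted permutation code is $C(T,\mathcal{I})=\{\alpha(t,\mathcal{I}): t\in T\}$. The $r$-fold repetition code $\mathrm{Rep}_r(C(T,\rho))$ is $C(T,(\rho,\ldots,\rho))$ with $r$ copies of $\rho$. Write $\delta_{tw}=\delta(C(T,\mathcal{I}))$ and $\delta_{rep}=\min_{\rho\in\mathcal{I}}\delta(\mathrm{Rep}_r(C(T,\rho)))$, where $r$ is the length of $\mathcal{I}$ (so $r=p$ in (a) and $r=2$ in (b)). If $T$ is a permutation group on $Q$, an automorphism $\sigma$ of $T$ is viewed as the representation sending $t$ to the permutation of $Q$ induced by $\sigma(t)$. Part (a). Let $V=\mathbb{F}_p^k$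 (row vectors). Let $A_k$ be the $k\times k$ matrix over $\mathbb{F}_p$ whose first row is $\mathbf{0}$ and whose $i$th row, for $i\geq 2$, is the standard basis vector $e_{i-1}$; let $B_k=I_k+A_k$, which satisfies $B_k^p=I_k$. For $i\geq 1$ let $\Omega(k,i)=I_k+B_k+\cdots+B_k^{i-1}$. For $\mathbf{v}\in V$ let $\varphi_{\mathbf{v}}$ be the translation $\mathbf{x}\mapsto\mathbf{x}+\mathbf{v}$ of $V$, and identify $B_k^i$ with the map $\mathbf{x}\mapsto\mathbf{x}B_k^i$. Maps act on the right and products are composed from left to right, so $\varphi_{\mathbf{v}}B_k^i$ is the map $\mathbf{x}\mapsto(\mathbf{x}+\mathbf{v})B_k^i$. Let $G_k=\langle\varphi_{\mathbf{v}}B_k^i:\mathbf{v}\in V,\ i\geq 1\rangle$, whose elements are exactly the maps $\varphi_{\mathbf{v}}B_k^i$, and let $$\overline{G}_k=\left\langle\begin{pmatrix}1&\mathbf{v}\\ \mathbf{0}&I\end{pmatrix}\begin{pmatrix}1&\mathbf{0}\\ \mathbf{0}&B_k^i\end{pmatrix}:\mathbf{v}\in V,\ i\geq 1\right\rangle\leq\mathrm{GL}(k+1,p).$$ For $\mathbf{w}\in V$ let $\tau_{\mathbf{w}}:G_k\to\overline{G}_k$ be the (well-defined) isomorphism $$\tau_{\mathbf{w}}(\varphi_{\mathbf{v}}B_k^i)=\begin{pmatrix}1&\mathbf{v}\\ \mathbf{0}&I\end{pmatrix}\begin{pmatrix}1&\mathbf{w}\,\Omega(k,i)\\ \mathbf{0}&B_k^i\end{pmatrix}.$$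 For $r\in\mathbb{F}_p$ let $\mathbf{w}_r=(0,\ldots,0,r)\in V$. The automorphism $\tau_{\mathbf{w}_r}\tau_{\mathbf{w}_0}^{-1}$ of $\overline{G}_k$ is $g\mapsto\tau_{\mathbf{w}_r}(\tau_{\mathbf{w}_0}^{-1}(g))$. Part (b). A transvection is an element $g$ with $g-1$ of rank $1$ and $(g-1)^2=0$. An outer automorphism $\tau$ of $\mathrm{Sp}(4,2^n)$ with the stated property exists for every $n\geq 1$. *)

(* Defs.v *)
From HB Require Import structures.
From mathcomp Require Import all_boot all_order all_fingroup all_algebra.
From mathcomp Require Import all_solvable all_field all_character.

Set Implicit Arguments.
Unset Strict Implicit.
Unset Printing Implicit Defensive.

Import GRing.Theory.
Local Open Scope ring_scope.

Section Codes.

Variables (Q : finType) (m : nat).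

Definition hamming (x y : m.-tuple Q) : nat :=
  #|[set i : 'I_m | tnth x i != tnth y i]|.

(* Hamming distances are at most [m], so the default value [m] of the iterated
   minimum matters only for codes with fewer than two codewords. *)
Definition min_distance (C : {set m.-tuple Q}) : nat :=
  \big[minn/m]_(xy in setX C C | xy.1 != xy.2) hamming xy.1 xy.2.

End Codes.

(* A permutation representation of a finite group [T] on [Q] is a morphism
   [{morphism T >-> {perm Q}}]; products in [{perm Q}] are composed from left to
   right.  The fixed ordering of [Q] is that of [enum Q]. *)
Section TwistedCodes.

Variables (gT : finGroupType) (T : {group gT}) (Q : finType).

Definition word (t : gT) (rho : {morphism T >-> {perm Q}}) : #|Q|.-tuple Q :=
  [tuple of [seq rho t x | x <- enum Q]].

Lemma size_twisted_word r (t : gT) (I : r.-tuple {morphism T >-> {perm Q}}) :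
  size (flatten [seq val (word t rho) | rho <- I]) == (r * #|Q|)%N.
Proof.
rewrite size_flatten /shape -map_comp sumnE big_map.
under eq_bigr => rho _ do rewrite [_ rho]size_tuple.
by rewrite big_const_seq count_predT size_tuple iter_addn_0 mulnC.
Qed.

Definition twisted_word r (t : gT) (I : r.-tuple {morphism T >-> {perm Q}}) :
    (r * #|Q|).-tuple Q :=
  Tuple (size_twisted_word t I).

Definition twisted_code r (I : r.-tuple {morphism T >-> {perm Q}}) :
    {set (r * #|Q|).-tuple Q} :=
  [set twisted_word t I | t in T].

Definition rep_code r (rho : {morphism T >-> {perm Q}}) :
    {set (r * #|Q|).-tuple Q} :=
  twisted_code [tuple of nseq r rho].

Definition delta_tw r (I : r.-tuple {morphism T >-> {perm Q}}) : nat :=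
  min_distance (twisted_code I).

(* The default value [r * #|Q|] matters only for the empty list [I]. *)
Definition delta_rep r (I : r.-tuple {morphism T >-> {perm Q}}) : nat :=
  \big[minn/(r * #|Q|)%N]_(rho <- I) min_distance (rep_code r rho).

Lemma aut_rep_subproof (rho : {morphism T >-> {perm Q}}) (a : {perm gT}) :
  a \in Aut T -> {in T &, {morph (fun t => rho (a t)) : x y / (x * y)%g}}.
Proof.
move=> Aa x y Tx Ty; have aM := morphicP (Aut_morphic Aa).
by rewrite aM // morphM ?Aut_closed.
Qed.

(* An automorphism [a] of [T], viewed as a representation of [T] through the
   given action [rho] of [T] on [Q]. *)
Definition aut_rep (rho : {morphism T >-> {perm Q}}) (a : {perm gT})
    (Aa : a \in Aut T) : {morphism T >-> {perm Q}} :=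
  Morphism (aut_rep_subproof rho Aa).

End TwistedCodes.

(* The representation of [T] on a subtype [sT] of [X] preserved by the action
   [to] of [T] on [X]. *)
Definition sub_rep (gT : finGroupType) (D T : {group gT}) (X : finType)
    (to : action D X) (P : pred X) (sT : subFinType P)
    (nPT : [acts T, on [set x | P x] | to]) : {morphism T >-> {perm sT}} :=
  [morphism of restrm nPT (actperm (@subaction _ _ _ _ sT to))].

Section AffineGL.

Variables (F : finFieldType) (k : nat).

Lemma affGL_unit (u : 'rV[F]_k) (L : 'M[F]_k) : L \in unitmx ->
  (block_mx 1%:M u 0 L : 'M[F]_k.+1) \is a GRing.unit.
Proof.
move=> uL; have : (block_mx 1%:M u 0 L : 'M[F]_(1 + k)) \in unitmx.
  by rewrite unitmxE det_ublock det1 mul1r.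
by [].
Qed.

Definition affGL (u : 'rV[F]_k) (L : 'M[F]_k) (uL : L \in unitmx) : {'GL_k.+1[F]} :=
  FinRing.unit _ (affGL_unit u uL).

Lemma linp_inj (L : 'M[F]_k) : L \in unitmx -> injective (fun x : 'rV[F]_k => x *m L).
Proof. by move=> uL; apply: can_inj (mulmxK uL). Qed.

Definition linp (L : 'M[F]_k) (uL : L \in unitmx) : {perm 'rV[F]_k} :=
  perm (linp_inj uL).

Definition transp (v : 'rV[F]_k) : {perm 'rV[F]_k} := perm (addIr v).

Lemma affGL_eq u u' L L' (uL : L \in unitmx) (uL' : L' \in unitmx) :
  u = u' -> L = L' -> affGL u uL = affGL u' uL'.
Proof. by move=> -> eL; case: _ / eL uL' => uL'; apply: val_inj. Qed.

Lemma affGL_inj u u' L L' (uL : L \in unitmx) (uL' : L' \in unitmx) :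
  affGL u uL = affGL u' uL' -> u = u' /\ L = L'.
Proof.
move/(congr1 val)=> /= e; have {}e : block_mx (1%:M : 'M_1) u 0 L = block_mx 1%:M u' 0 L'.
  exact: e.
by have [_ -> _ ->] := eq_block_mx e.
Qed.

Lemma affGLM u u' L L' (uL : L \in unitmx) (uL' : L' \in unitmx)
    (uLL' : L *m L' \in unitmx) :
  (affGL u uL * affGL u' uL')%g = affGL (u' + u *m L') uLL'.
Proof.
apply: val_inj.
have : block_mx 1%:M u 0 L *m block_mx 1%:M u' 0 L' =
    block_mx 1%:M (u' + u *m L') 0 (L *m L') :> 'M_(1 + k).
  by rewrite mulmx_block !mul1mx !mul0mx !mulmx0 !addr0 add0r.
by [].
Qed.

End AffineGL.

Section AffineExample.

Variables (p k : nat).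
Local Notation V := 'rV['F_p]_k.

Definition Amx : 'M['F_p]_k := \matrix_(i, j) (i == j.+1 :> nat)%:R.
Definition Bmx : 'M['F_p]_k := 1%:M + Amx.
Definition Omega_mx (i : nat) : 'M['F_p]_k := \sum_(j < i) Bmx ^+ j.

Lemma Amx_exp m i j : (Amx ^+ m) i j = (i == (j + m)%N :> nat)%:R.
Proof.
elim: m i j => [|m IHm] i j; first by rewrite expr0 mxE addn0 -val_eqE.
rewrite exprS -[_ * _]/(_ *m _) mxE.
under eq_bigr => l _ do rewrite IHm mxE.
have [ltjk | lekj] := ltnP (j + m) k.
  rewrite (bigD1 (Ordinal ltjk)) //= eqxx mulr1 addnS big1 ?addr0 // => l.
  by rewrite -val_eqE => /negPf /= ->; rewrite mulr0.
rewrite big1 => [|l _]; last first.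
  by rewrite [l == _ :> nat]ltn_eqF ?mulr0 // (leq_trans (ltn_ord l)).
by rewrite ltn_eqF // (leq_trans (ltn_ord i)) // addnS (leq_trans lekj).
Qed.

Lemma Amx_nilp m : (k <= m)%N -> Amx ^+ m = 0.
Proof.
move=> lekm; apply/matrixP=> i j; rewrite Amx_exp mxE ltn_eqF //.
by rewrite (leq_trans (ltn_ord i)) // (leq_trans lekm) ?leq_addl.
Qed.

Lemma Omega_mxD i j : Omega_mx (i + j) = Omega_mx j + Omega_mx i *m Bmx ^+ j.
Proof.
rewrite /Omega_mx addnC big_split_ord /=; congr (_ + _).
rewrite mulmx_suml; apply: eq_bigr => l _.
by rewrite addnC exprD.
Qed.

Lemma Bmx_unit i : Bmx ^+ i \in unitmx.
Proof.
have uB : Bmx \in unitmx.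
  have detB : \det Bmx = 1.
    rewrite det_trig; last first.
      apply/is_trig_mxP => i' j ltij; rewrite !mxE -val_eqE (ltn_eqF ltij) add0r.
      by rewrite ltn_eqF // ltnS ltnW.
    by rewrite big1 // => l _; rewrite !mxE eqxx ltn_eqF ?addr0.
  by rewrite unitmxE detB unitr1.
elim: i => [|i IHi]; first by rewrite expr0 unitmx1.
by rewrite exprS -[_ * _]/(_ *m _) unitmx_mul uB.
Qed.

Definition Blin (i : nat) : {perm V} := linp (Bmx_unit i).
Definition Bgl (i : nat) (u : V) : {'GL_k.+1['F_p]} := affGL u (Bmx_unit i).
Definition transgl (v : V) : {'GL_k.+1['F_p]} := affGL v (unitmx1 _ _).

(* When [p] is prime and [k < p], [B ^+ p = 1], so the exponents in [1, p]
   account for all exponents [i >= 1]; see [Gperm_mem] and [Gbar_mem]. *)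
Definition Gset : {set {perm V}} :=
  [set (transp v * Blin i.+1)%g | v : V, i : 'I_p].
Definition Gperm : {group {perm V}} := <<Gset>>%G.
Definition Gbar : {group {'GL_k.+1['F_p]}} :=
  <<[set (transgl v * Bgl i.+1 0)%g | v : V, i : 'I_p]>>%G.

Definition tau_mx (w v : V) (i : nat) : {'GL_k.+1['F_p]} :=
  (transgl v * Bgl i (w *m Omega_mx i))%g.

(* The exponent and translation of a preimage are recovered by choice; the value
   does not depend on them, see [tau_funE]. *)
Definition tau_fun (w : V) (g : {perm V}) : {'GL_k.+1['F_p]} :=
  if [pick vi : V * 'I_p | g == (transp vi.1 * Blin vi.2.+1)%g] is Some vi
  then tau_mx w vi.1 vi.2.+1 else 1%g.

Lemma tau_mxE w v i :
  tau_mx w v i = Bgl i (w *m Omega_mx i + v *m Bmx ^+ i).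
Proof.
have uB : 1%:M *m Bmx ^+ i \in unitmx by rewrite mul1mx Bmx_unit.
by rewrite /tau_mx (affGLM _ _ _ _ uB); apply: affGL_eq; rewrite ?mul1mx.
Qed.

Lemma tau_mx0 v i : tau_mx 0 v i = (transgl v * Bgl i 0)%g.
Proof. by rewrite /tau_mx mul0mx. Qed.

Lemma transp_linE v i x : (transp v * Blin i)%g x = (x + v) *m Bmx ^+ i.
Proof. by rewrite permM !permE. Qed.

Hypotheses (p_pr : prime p) (k_gt1 : (1 < k)%N) (k_ltp : (k < p)%N).

Lemma Omega_mxp : Omega_mx p = 0.
Proof.
have pcharP : p \in [pchar {poly 'F_p}] by rewrite pchar_poly pchar_Fp.
have Sp : \sum_(j < p) (1 + 'X) ^+ j = 'X^(p.-1) :> {poly 'F_p}.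
  apply: (mulfI (negbT (polyX_eq0 'F_p))); rewrite -exprS prednK ?prime_gt0 //.
  have X1 : 'X = 1 + 'X - 1 :> {poly 'F_p} by rewrite addrC addKr.
  rewrite [X in X * _]X1 -subrX1.
  rewrite -!(pFrobenius_autE pcharP) pFrobenius_autD_comm; last exact: mulrC.
  by rewrite pFrobenius_aut1 addrC addKr.
have k_gt0 : (0 < k)%N by apply: ltnW.
rewrite /Omega_mx /Bmx; have := Amx_nilp.
case: k k_gt0 k_ltp Amx => // k' _ ltkp A nilA.
transitivity (horner_mx A (\sum_(j < p) (1 + 'X) ^+ j)).
  rewrite rmorph_sum; apply: eq_bigr => j _.
  by rewrite rmorphXn rmorphD rmorph1 /= horner_mx_X.
by rewrite Sp rmorphXn /= horner_mx_X nilA // -ltnS prednK ?prime_gt0.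
Qed.

Lemma Bmxp : Bmx ^+ p = 1.
Proof. by apply/eqP; rewrite -subr_eq0 subrX1 -/(Omega_mx p) Omega_mxp mulr0. Qed.

Lemma Bmx_mulp m : Bmx ^+ (p * m) = 1.
Proof. by rewrite exprM Bmxp expr1n. Qed.

Lemma Omega_mx_mulp m : Omega_mx (p * m) = 0.
Proof.
elim: m => [|m IHm]; first by rewrite muln0 /Omega_mx big_ord0.
by rewrite mulnS Omega_mxD IHm Omega_mxp mul0mx addr0.
Qed.

Lemma Bmx_eq1 i : Bmx ^+ i = 1 -> (p %| i)%N.
Proof.
have Bne1 : Bmx != 1.
  apply/eqP=> /matrixP/(_ (Ordinal k_gt1) (Ordinal (ltnW k_gt1))).
  by rewrite !mxE /= add0r => /eqP; rewrite oner_eq0.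
move=> Bi; apply: contraR Bne1; rewrite -prime_coprime // => /eqP co_pi.
have [u v def_u _] := egcdnP i (prime_gt0 p_pr).
have : Bmx ^+ (u * p) = Bmx ^+ (v * i + 1) by rewrite def_u co_pi.
by rewrite mulnC Bmx_mulp mulnC exprD exprM Bi expr1n mul1r expr1 => <-.
Qed.

Lemma Bmx_Omega_eq i j : Bmx ^+ i = Bmx ^+ j -> Omega_mx i = Omega_mx j.
Proof.
wlog le_ij: i j / (i <= j)%N => [IH eB|].
  by case/orP: (leq_total i j) => [/IH-> | /IH->].
move: le_ij => /subnK <-; move: (j - i)%N => d; rewrite exprD -{1}[_ ^+ i]mul1r.
move/(congr1 (mulmxr (invmx (Bmx ^+ i)))); rewrite /= !mulmxK ?Bmx_unit //.
by move/esym/Bmx_eq1/dvdnP=> [m ->]; rewrite Omega_mxD mulnC Omega_mx_mulp mul0mx addr0.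
Qed.

Lemma transp_lin_inj v v' i j :
  (transp v * Blin i = transp v' * Blin j)%g -> v = v' /\ Bmx ^+ i = Bmx ^+ j.
Proof.
move=> eqg; have E x : (x + v) *m Bmx ^+ i = (x + v') *m Bmx ^+ j.
  by rewrite -!transp_linE eqg.
have eB : Bmx ^+ i = Bmx ^+ j.
  apply/row_matrixP=> l; rewrite !rowE.
  by have := E (delta_mx 0 l); have := E 0; rewrite !mulmxDl !mul0mx !add0r => -> /addIr.
split=> //; have := E 0; rewrite !add0r eB => /(congr1 (mulmxr (invmx (Bmx ^+ j)))).
by rewrite /= !mulmxK ?Bmx_unit.
Qed.

Lemma exp_red i : exists j : 'I_p, Bmx ^+ i = Bmx ^+ j.+1.
Proof.
have p_gt0 := prime_gt0 p_pr.
exists (Ordinal (ltn_pmod (i + p.-1) p_gt0)) => /=.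
have := congr1 (fun n => Bmx ^+ n.+1) (divn_eq (i + p.-1) p).
rewrite -addnS prednK // -[X in _ = _ ^+ X]addnS [in RHS]mulnC.
by rewrite !exprD Bmxp Bmx_mulp mulr1 mul1r.
Qed.

Lemma Gset_mem v i : (transp v * Blin i)%g \in Gset.
Proof.
have [j Bij] := exp_red i; apply/imset2P; exists v j; rewrite ?inE //.
by apply/permP=> x; rewrite !transp_linE Bij.
Qed.

Lemma Gset_mul v i v' i' : (transp v * Blin i * (transp v' * Blin i') =
  transp (v + v' *m invmx (Bmx ^+ i)) * Blin (i + i'))%g.
Proof.
apply/permP=> x; rewrite permM !transp_linE exprD -[_ * _]/(_ *m _) mulmxA.
by rewrite addrA [in RHS]mulmxDl mulmxKV ?Bmx_unit.
Qed.

Lemma Gset_group : group_set Gset.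
Proof.
apply/group_setP; split=> [|g h].
  suff -> : (1 : {perm V})%g = (transp 0 * Blin 0)%g by apply: Gset_mem.
  by apply/permP=> x; rewrite transp_linE addr0 expr0 mulmx1 perm1.
case/imset2P=> v i _ _ -> /imset2P[v' i' _ _ ->].
by rewrite Gset_mul Gset_mem.
Qed.

Lemma GpermE : Gperm = Gset :> {set _}.
Proof. exact: (gen_set_id Gset_group). Qed.

Lemma Gperm_mem v i : (transp v * Blin i)%g \in Gperm.
Proof. by rewrite GpermE Gset_mem. Qed.

Lemma GpermP g :
  reflect (exists v : V, exists i : nat, (0 < i)%N /\ g = (transp v * Blin i)%g)
          (g \in Gperm).
Proof.
apply: (iffP idP) => [|[v [i [_ ->]]]]; last exact: Gperm_mem.
by rewrite GpermE => /imset2P[v i _ _ ->]; exists v, i.+1.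
Qed.

Lemma Gbar_mem v i : (transgl v * Bgl i 0)%g \in Gbar.
Proof.
have [j Bij] := exp_red i; rewrite mem_gen //; apply/imset2P; exists v j => //.
by congr (_ * _)%g; apply: affGL_eq.
Qed.

Lemma tau_funE w v i : tau_fun w (transp v * Blin i)%g = tau_mx w v i.
Proof.
rewrite /tau_fun; case: pickP => [[u j] /eqP /= | ].
  move/transp_lin_inj => [-> eB]; rewrite !tau_mxE; apply: affGL_eq => //.
  by rewrite (Bmx_Omega_eq eB) eB.
have := Gset_mem v i => /imset2P[u j _ _ E] /(_ (u, j)) /=.
by rewrite E eqxx.
Qed.

Lemma tau_morphM w : {in Gperm &, {morph tau_fun w : g h / (g * h)%g}}.
Proof.
move=> _ _ /GpermP[v [i [_ ->]]] /GpermP[v' [j [_ ->]]].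
rewrite Gset_mul !tau_funE !tau_mxE.
have uB : Bmx ^+ i *m Bmx ^+ j \in unitmx by rewrite unitmx_mul !Bmx_unit.
rewrite (affGLM _ _ _ _ uB); apply: affGL_eq; rewrite exprD //.
rewrite Omega_mxD mulmxDr -[_ * _]/(_ *m _) !mulmxA [_ *m Bmx ^+ i]mulmxDl.
rewrite mulmxKV ?Bmx_unit // !mulmxDl.
by rewrite [RHS]addrACA [v' *m _ + _]addrC.
Qed.

Definition tau (w : V) : {morphism Gperm >-> {'GL_k.+1['F_p]}} :=
  Morphism (@tau_morphM w).

Lemma injm_tau w : ('injm (tau w))%g.
Proof.
apply/injmP=> _ _ /GpermP[v [i [_ ->]]] /GpermP[v' [j [_ ->]]].
rewrite /= !tau_funE !tau_mxE => /affGL_inj[+ eB].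
rewrite (Bmx_Omega_eq eB) -eB => /addrI/(congr1 (mulmxr (invmx (Bmx ^+ i)))).
rewrite /= !mulmxK ?Bmx_unit // => ->.
by apply/permP=> x; rewrite !transp_linE eB.
Qed.

Lemma im_tau0 : (tau 0 @* Gperm)%g = Gbar.
Proof.
rewrite morphim_gen ?subset_gen //; congr <<_>>%g.
rewrite morphimEsub ?subset_gen //; apply/setP=> g; apply/imsetP/imset2P.
  by move=> [_ /imset2P[v i _ _ ->] ->]; exists v i; rewrite // /= tau_funE tau_mx0.
move=> [v i _ _ ->]; exists (transp v * Blin i.+1)%g; first exact: imset2_f.
by rewrite /= tau_funE tau_mx0.
Qed.

Lemma im_tau w : (tau w @* Gperm)%g = Gbar.
Proof.
apply/eqP; rewrite eqEcard -{2}im_tau0 !card_injm ?injm_tau // leqnn andbT.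
apply/subsetP=> _ /morphimP[_ _ /GpermP[v [i [_ ->]]] ->].
have := Gbar_mem (w *m Omega_mx i *m invmx (Bmx ^+ i) + v) i.
rewrite -tau_mx0 !tau_mxE mul0mx add0r mulmxDl mulmxKV ?Bmx_unit //.
by rewrite /= tau_funE tau_mxE.
Qed.

Definition twist_fun (w : V) (g : {'GL_k.+1['F_p]}) : {'GL_k.+1['F_p]} :=
  tau w (invm (injm_tau 0) g).

Lemma twist_morphM w : {in Gbar &, {morph twist_fun w : g h / (g * h)%g}}.
Proof.
have mem_inv g : g \in (tau 0 @* Gperm)%g -> invm (injm_tau 0) g \in Gperm.
  by move=> Gg; have := mem_morphim (invm_morphism (injm_tau 0)) Gg Gg; rewrite im_invm.
rewrite -im_tau0 => g h Gg Gh.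
by rewrite /twist_fun [invm _ _]morphM // [LHS]morphM ?mem_inv.
Qed.

Definition twist (w : V) : {morphism Gbar >-> {'GL_k.+1['F_p]}} :=
  Morphism (@twist_morphM w).

Lemma twistE w v i : twist w (transgl v * Bgl i 0)%g = tau_mx w v i.
Proof.
rewrite -tau_mx0 -tau_funE /= /twist_fun -[tau_fun 0 _]/(tau 0 _).
by rewrite invmE ?Gperm_mem //= tau_funE.
Qed.

Lemma im_twist w : (twist w @* Gbar)%g = Gbar.
Proof.
have mem0 h : h \in Gperm -> tau 0 h \in Gbar.
  by move=> Gh; rewrite -im_tau0 mem_morphim.
have twist0 h : h \in Gperm -> twist w (tau 0 h) = tau w h.
  by move=> Gh; rewrite /= /twist_fun [invm _ _]invmE.
apply/setP=> g; apply/idP/idP.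
  case/morphimP=> x _; rewrite -{1}im_tau0 => /morphimP[h _ Gh ->] ->.
  by rewrite [twist _ _]twist0 // -(im_tau w) mem_morphim.
rewrite -{1}(im_tau w) => /morphimP[h _ Gh ->].
by rewrite -[tau w h]twist0 // mem_morphim ?mem0.
Qed.

Lemma injm_twist w : ('injm (twist w))%g.
Proof.
by apply/injmP/imset_injP; rewrite -morphimEdom im_twist.
Qed.

(* The automorphism [g |-> tau_w (tau_0^-1 g)] of [Gbar]. *)
Definition twist_aut (w : V) : {perm {'GL_k.+1['F_p]}} :=
  aut (injm_twist w) (im_twist w).

Lemma twist_autP w : twist_aut w \in Aut Gbar.
Proof. exact: Aut_aut. Qed.

Definition affine_point := {x : 'rV['F_p]_k.+1 | x 0 0 == 1}.

Lemma affGL_00 (u : V) (L : 'M_k) (uL : L \in unitmx) (x : 'rV_k.+1) :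
  (x *m GLval (affGL u uL)) 0 0 = x 0 0.
Proof.
have E (y : 'rV['F_p]_(1 + k)) :
    (y *m block_mx (1%:M : 'M_1) u 0 L) 0 (lshift k 0) = y 0 (lshift k 0).
  by rewrite -[y]hsubmxK mul_row_block mulmx1 mulmx0 addr0 !row_mxEl.
have -> : (0 : 'I_k.+1) = lshift k (0 : 'I_1) by apply: val_inj.
exact: E.
Qed.

Lemma Gbar_acts : [acts Gbar, on [set x : 'rV['F_p]_k.+1 | x 0 0 == 1] |
                                 'MR (GLrepr 'F_p k)].
Proof.
rewrite gen_subG; apply/subsetP=> _ /imset2P[v i _ _ ->].
rewrite !inE /=; apply/subsetP=> x; rewrite !inE /= mx_repr_actE ?inE //.
by rewrite -tau_mx0 tau_mxE affGL_00.
Qed.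

Definition Gbar_rep : {morphism Gbar >-> {perm affine_point}} :=
  @sub_rep _ _ _ _ _ _ affine_point Gbar_acts.

Lemma Gbar_repE g x : g \in Gbar -> val (Gbar_rep g x) = val x *m GLval g.
Proof.
move=> Gg; rewrite /= /restrm actpermE /= val_subact (subsetP Gbar_acts) //.
by rewrite /= mx_repr_actE ?inE.
Qed.

(* [w_r = (0, ..., 0, r)] *)
Definition w_ (r : 'F_p) : V := \row_(j < k) (if j == k.-1 :> nat then r else 0).

Definition affine_twists : p.-tuple {morphism Gbar >-> {perm affine_point}} :=
  [tuple aut_rep Gbar_rep (twist_autP (w_ r%:R)) | r < p].

End AffineExample.

Definition Inn (gT : finGroupType) (G : {group gT}) : {set {perm gT}} :=
  (conj_aut G @* G)%g.

Section SymplecticExample.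

Variables (F : finFieldType) (form : {skew_symmetric 'rV[F]_4}).

Definition Sp_set : {set {'GL_4[F]}} :=
  [set g : {'GL_4[F]} |
    [forall u, [forall v, form (u *m GLval g) (v *m GLval g) == form u v]]].

Lemma Sp_setP (g : {'GL_4[F]}) :
  reflect (forall u v, form (u *m GLval g) (v *m GLval g) = form u v)
          (g \in Sp_set).
Proof.
rewrite inE; apply: (iffP forallP) => [H u v | H u].
  exact/eqP/(forallP (H u)).
by apply/forallP=> v; apply/eqP.
Qed.

Lemma Sp_group_set : group_set Sp_set.
Proof.
apply/group_setP; split=> [|g h /Sp_setP Sg /Sp_setP Sh]; apply/Sp_setP=> u v.
  by rewrite !mulmx1.
by rewrite GL_MxE !mulmxA Sh Sg.
Qed.

Definition Sp : {group {'GL_4[F]}} := Group Sp_group_set.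

Definition is_transvection (g : {'GL_4[F]}) : bool :=
  (\rank (GLval g - 1) == 1%N) && ((GLval g - 1) ^+ 2 == 0).

(* One-dimensional subspaces are represented by their sets of vectors. *)
Definition is_pg_point (L : {set 'rV[F]_4}) : bool :=
  [exists v : 'rV[F]_4, (v != 0) && (L == [set a *: v | a : F])].

Definition PG := {L : {set 'rV[F]_4} | is_pg_point L}.

Lemma Sp_acts : [acts Sp, on [set L | is_pg_point L] | ('MR (GLrepr F 3))^*].
Proof.
apply/subsetP=> g _; rewrite !inE /=; apply/subsetP=> L; rewrite !inE.
have ug : GLval g \in unitmx := GL_unitmx g.
case/existsP=> v /andP[nz_v /eqP ->]; apply/existsP; exists (v *m GLval g).
apply/andP; split.
  apply: contra nz_v => /eqP/(congr1 (mulmxr (invmx (GLval g)))).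
  by rewrite /= mul0mx (mulmxK ug) => ->.
rewrite /setact -imset_comp; apply/eqP/eq_imset => a /=.
by rewrite mx_repr_actE ?inE // -scalemxAl.
Qed.

Definition Sp_rep : {morphism Sp >-> {perm PG}} :=
  @sub_rep _ _ _ _ _ _ PG Sp_acts.

Lemma Sp_repE g L : g \in Sp ->
  val (Sp_rep g L) = [set u *m GLval g | u in val L].
Proof.
move=> Sg; rewrite /= /restrm actpermE /= val_subact (subsetP Sp_acts) //.
by apply: eq_imset => u /=; rewrite mx_repr_actE ?inE.
Qed.

Definition pg_fixed (g : {'GL_4[F]}) : {set PG} := [set L | Sp_rep g L == L].

Definition symplectic_twists (tau : {perm {'GL_4[F]}}) (Atau : tau \in Aut Sp) :
    2.-tuple {morphism Sp >-> {perm PG}} :=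
  [tuple aut_rep Sp_rep (group1 [Aut Sp]); aut_rep Sp_rep Atau].

End SymplecticExample.

(* Main.v *)
(** The words of [t] and [s] agree exactly at the fixed points of [t s^-1], so
    the minimum distance is the least number of points moved, summed over the
    list of representations, by a nontrivial element of [T].

    (a) Let [t] be [phi_v B^i].  If [p] divides [i], then [t] is a nontrivial
    translation and moves every point under each twist.  Otherwise
    [B^i - 1 = A Omega_i] with [Omega_i] invertible, and [y] is fixed by the
    twist of [t] by [w] iff [y A = - (w + v B^i Omega_i^-1)].  The image of [A] is
    the hyperplane of vectors with last coordinate zero, so exactly one of the
    [w_r] yields fixed points, and it yields [#|ker A| = p] of them.

    (b) With [q = 2^n], the number of points fixed by [g] is the sum of
    [1 + q + ... + q^(d-1)] over the eigenspaces of [g], of dimension [d].  In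
    [Sp(4, q)], an eigenspace of dimension at least [3] is not totally isotropic,
    so its eigenvalue squares to [1], hence is [1], and [g] is the identity or a
    transvection; thus [g] fixes [q^2 + q + 1] points if it is a transvection, and
    at most [min (2 (q + 1)) (q^2 - 1)] points if it is nontrivial and not a
    transvection.  If [tau t] is a transvection but [t] is not, then [t] is still
    an involution, hence unipotent, and fixes at most [q + 1] points. *)

Require Import Defs.
From mathcomp Require Import all_boot all_order all_fingroup all_algebra.
From mathcomp Require Import all_solvable all_field all_character.
From mathcomp Require Import zify.

Set Implicit Arguments.
Unset Strict Implicit.
Unset Printing Implicit Defensive.

Import GRing.Theory.
Local Open Scope ring_scope.

Lemma bigminn_leq (I : eqType) (r : seq I) (P : pred I) (F : I -> nat) d i :
  i \in r -> P i -> (\big[minn/d]_(j <- r | P j) F j <= F i)%N.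
Proof.
move=> ri Pi; elim: r ri => // j r IHr; rewrite in_cons big_cons.
case/predU1P=> [<- | /IHr le_r]; first by rewrite Pi geq_minl.
by case: ifP => // _; rewrite geq_min le_r orbT.
Qed.

Lemma sum_tnth2 (A : Type) (x y : A) (f : A -> nat) :
  (\sum_(i < 2) f (tnth [tuple x; y] i) = f x + f y)%N.
Proof. by rewrite !big_ord_recl big_ord0 addn0. Qed.

(** * Minimum distance of a code *)

Section MinDistance.

Variables (Q : finType) (m : nat).
Implicit Types (x y : m.-tuple Q) (C : {set m.-tuple Q}).

(** Counting over [zip] lets the distance split along concatenated words. *)
Lemma hamming_zip x y :
  hamming x y = count (fun ab => ab.1 != ab.2) (zip x y).
Proof.
have -> : zip x y = [seq (tnth x i, tnth y i) | i <- enum 'I_m].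
  by rewrite -zip_map !map_tnth_enum.
by rewrite count_map /hamming cardsE cardE size_filter -enumT.
Qed.

Lemma min_distance_le C : (min_distance C <= m)%N.
Proof.
by rewrite /min_distance; elim/big_ind: _ => // [a b le_a _|? _];
  [rewrite geq_min le_a | rewrite /hamming -[leqRHS]card_ord max_card].
Qed.

Lemma min_distance_eq C d :
    {in C &, forall x y, x != y -> d <= hamming x y}%N ->
    (exists x y, [/\ x \in C, y \in C, x != y & hamming x y = d]) ->
  min_distance C = d.
Proof.
move=> lb [x [y [Cx Cy neq_xy dxy]]].
(* The iterated minimum starts from the default [m], so [d] must not exceed it. *)
have le_dm : (d <= m)%N by rewrite -dxy /hamming -[leqRHS]card_ord max_card.
apply/eqP; rewrite eqn_leq; apply/andP; split; last first.
  rewrite /min_distance; elim/big_ind: _ => // [a b le_a le_b|[a b]].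
    by rewrite leq_min le_a.
  by rewrite inE => /andP[/andP[]]; apply: lb.
have Pxy : ((x, y) \in setX C C) && ((x, y).1 != (x, y).2) by rewrite inE Cx Cy.
by rewrite -dxy; apply: (bigminn_leq _ _ (mem_index_enum (x, y)) Pxy).
Qed.

End MinDistance.

(** * Distances in twisted and repetition codes *)

Section TwistedCodes.

Variables (gT : finGroupType) (T : {group gT}) (Q : finType).
Implicit Types (t s : gT) (rho : {morphism T >-> {perm Q}}).

Definition moved rho t := #|[set x | rho t x != x]|.

Lemma movedE rho t : moved rho t = (#|Q| - #|[set x | rho t x == x]|)%N.
Proof.
by rewrite /moved cardsCs; congr (_ - _)%N; apply: eq_card => x; rewrite !inE negbK.
Qed.

Lemma hamming_twisted_word r (I : r.-tuple {morphism T >-> {perm Q}}) t s :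
    t \in T -> s \in T ->
  hamming (twisted_word t I) (twisted_word s I) =
    (\sum_(i < r) moved (tnth I i) (t * s^-1)%g)%N.
Proof.
move=> Tt Ts; rewrite hamming_zip -(big_tuple _ _ I xpredT (moved^~ _)) /=.
elim: (val I) => [|rho J IHJ]; first by rewrite big_nil.
rewrite big_cons -{}IHJ /= zip_cat ?size_tuple // count_cat; congr (_ + _)%N.
rewrite zip_map count_map /moved cardsE cardE size_filter -enumT.
apply: eq_count => x; transitivity (rho (t * s^-1)%g x != x) => //=.
by rewrite morphM ?groupV // morphV // permM (canF_eq (permKV _)).
Qed.

Lemma delta_tw_eq r (I : r.-tuple {morphism T >-> {perm Q}}) d :
    (0 < d)%N ->
    {in T, forall t, t != 1%g -> d <= \sum_(i < r) moved (tnth I i) t}%N ->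
    (exists t, [/\ t \in T, t != 1%g & \sum_(i < r) moved (tnth I i) t = d])%N ->
  delta_tw I = d.
Proof.
move=> d_gt0 lb [t [Tt t_neq1 def_d]]; apply: min_distance_eq => [x y|].
  case/imsetP=> s Ts -> /imsetP[u Tu ->] neq_su.
  rewrite hamming_twisted_word // lb ?groupM ?groupV //.
  by apply: contraNneq neq_su => /eqP; rewrite -eq_mulgV1 => /eqP->.
have dist_t : hamming (twisted_word t I) (twisted_word 1%g I) = d.
  by rewrite hamming_twisted_word // invg1 mulg1.
exists (twisted_word t I), (twisted_word 1%g I).
(* The words of [t] and [1] are distinct because their distance [d] is positive. *)
split; rewrite ?imset_f //; apply: contraTneq d_gt0 => eq_t.
rewrite -dist_t eq_t /hamming -leqNgt leqn0 cards_eq0; apply/eqP/setP=> i.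
by rewrite !inE eqxx.
Qed.

(** Repeating one representation [r] times multiplies every distance by [r], and here all members of
    [I] share the same least value [d]. *)
Lemma delta_rep_eq r (I : r.-tuple {morphism T >-> {perm Q}}) d :
    (0 < r)%N -> (0 < d)%N ->
    (forall i, {in T, forall t, t != 1%g -> d <= moved (tnth I i) t})%N ->
    (forall i, exists t, [/\ t \in T, t != 1%g & moved (tnth I i) t = d]) ->
  delta_rep I = (r * d)%N.
Proof.
move=> r_gt0 d_gt0 lb att.
have rep_d i : min_distance (rep_code r (tnth I i)) = (r * d)%N.
  have sumE t : (\sum_(j < r) moved (tnth [tuple of nseq r (tnth I i)] j) t =
                r * moved (tnth I i) t)%N.
    under eq_bigr do rewrite tnth_nseq.
    by rewrite sum_nat_const card_ord.
  apply: delta_tw_eq; first by rewrite muln_gt0 r_gt0.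
    by move=> t Tt t_neq1; rewrite sumE leq_mul // lb.
  by have [t [Tt t_neq1 <-]] := att i; exists t.
(* The default [r * #|Q|] of the iterated minimum is no smaller than the claimed value. *)
have le_d : (r * d <= r * #|Q|)%N by rewrite -(rep_d (Ordinal r_gt0)) min_distance_le.
rewrite /delta_rep big_tuple; under eq_bigr do rewrite rep_d.
apply/eqP; rewrite eqn_leq; apply/andP; split.
  exact: (bigminn_leq _ _ (mem_index_enum (Ordinal r_gt0))).
by elim/big_ind: _ => // a b le_a le_b; rewrite leq_min le_a.
Qed.

End TwistedCodes.

(** * Fixed points of the affine twists, and part (a) *)

Section AffineFixedPoints.

Variables (p k : nat).
Local Notation V := 'rV['F_p]_k.

Lemma affine_lift_subproof (y : V) :
  ((row_mx 1%:M y : 'rV['F_p]_(1 + k)) : 'rV['F_p]_k.+1) 0 0 == 1.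
Proof.
have -> : (0 : 'I_k.+1) = lshift k (0 : 'I_1) by apply: val_inj.
by rewrite [_ 0 _](row_mxEl 1%:M y 0 0) mxE.
Qed.

Definition affine_lift (y : V) : affine_point p k :=
  exist _ (row_mx 1%:M y : 'rV['F_p]_(1 + k)) (affine_lift_subproof y).

Lemma affine_lift_bij : bijective affine_lift.
Proof.
exists (fun x => rsubmx (val x : 'rV['F_p]_(1 + k))) => [y | [x x00]].
  by rewrite row_mxKr.
apply: val_inj => /=; rewrite -[RHS](@hsubmxK _ 1 1 k); congr row_mx.
apply/rowP=> i; rewrite !ord1 !mxE eqxx -(eqP x00); congr (x _ _).
exact: val_inj.
Qed.

Lemma affine_lift_affGL (y u : V) L (uL : L \in unitmx) :
  val (affine_lift y) *m GLval (affGL u uL) = val (affine_lift (u + y *m L)).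
Proof.
have : row_mx 1%:M y *m block_mx 1%:M u 0 L = row_mx 1%:M (u + y *m L) :> 'M_(1, 1 + k).
  by rewrite mul_row_block !mul1mx mulmx0 addr0.
by [].
Qed.

Lemma card_fix_affGL (u : V) L (uL : L \in unitmx) : affGL u uL \in Gbar p k ->
  #|[set x | Gbar_rep p k (affGL u uL) x == x]| = #|[set y | u + y *m L == y]|.
Proof.
move=> Gg; rewrite -(on_card_preimset (onW_bij _ affine_lift_bij)).
apply: eq_card => y; rewrite !inE -val_eqE Gbar_repE // affine_lift_affGL val_eqE.
exact: (inj_eq (bij_inj affine_lift_bij)).
Qed.

Lemma affGL1 : affGL (0 : V) (unitmx1 _ _) = 1%g.
Proof. by apply: val_inj; apply: esym (scalar_mx_block 1 k 1). Qed.

Lemma card_affine_point : prime p -> #|{: affine_point p k}| = (p ^ k)%N.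
Proof.
move=> p_pr; rewrite -(bij_eq_card affine_lift_bij).
by rewrite card_mx card_Fp // mul1n.
Qed.

(** The geometric sum telescopes, with [B - 1 = A]; this turns a fixed-point equation for [B^i] into
    one for [A]. *)
Lemma Bmx_subr1 i : Bmx p k ^+ i - 1 = Amx p k *m Omega_mx p k i.
Proof.
by rewrite subrX1 -/(Omega_mx p k i) [Bmx p k - 1]addrAC subrr add0r.
Qed.

(** Powers of [B] are lower unitriangular, so [Omega_i] is lower triangular with diagonal entries
    [i], nonzero in ['F_p]. *)
Lemma Omega_mx_unit i : prime p -> ~~ (p %| i)%N -> Omega_mx p k i \in unitmx.
Proof.
move=> p_pr p'i; rewrite /Omega_mx.
have trigB j : (forall a b : 'I_k, (a < b)%N -> (Bmx p k ^+ j) a b = 0) /\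
               (forall a : 'I_k, (Bmx p k ^+ j) a a = 1).
  elim: j => [|j [IH0 IH1]].
    by split=> [a b ltab | a]; rewrite expr0 mxE ?eqxx // -val_eqE ltn_eqF.
  have E a b : (Bmx p k ^+ j.+1) a b = \sum_c (Bmx p k ^+ j) a c *
     ((c == b)%:R + (c == b.+1 :> nat)%:R).
    by rewrite exprSr mxE; apply: eq_bigr => c _; rewrite !mxE.
  split=> [a b ltab | a]; rewrite E.
    rewrite big1 // => c _; have [ltac | leca] := ltnP a c; first by rewrite IH0 ?mul0r.
    have ltcb := leq_ltn_trans leca ltab.
    by rewrite -val_eqE /= (ltn_eqF ltcb) (ltn_eqF (leqW ltcb)) addr0 mulr0.
  rewrite (bigD1 a) //= IH1 eqxx ltn_eqF // addr0 mulr1 big1 ?addr0 // => c neq_ca.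
  have [ltac | leca] := ltnP a c; first by rewrite IH0 ?mul0r.
  by rewrite (negPf neq_ca) ltn_eqF ?ltnS // addr0 mulr0.
rewrite unitmxE det_trig; last first.
  apply/is_trig_mxP => a b ltab; rewrite summxE big1 // => j _.
  by have [-> //] := trigB j.
rewrite unitfE prodf_seq_neq0; apply/allP=> a _ /=; rewrite summxE.
under eq_bigr => j _ do rewrite (trigB j).2.
by rewrite sumr_const card_ord -(dvdn_pcharf (pchar_Fp p_pr)).
Qed.

Hypotheses (p_pr : prime p) (k_gt1 : (1 < k)%N) (k_ltp : (k < p)%N).

(** Right multiplication by [A] shifts coordinates one place to the left, a zero entering at the
    end. *)
Lemma row_mul_Amx (y : V) (j c : 'I_k) : c = j.+1 :> nat -> (y *m Amx p k) 0 j = y 0 c.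
Proof.
move=> def_c; rewrite mxE (bigD1 c) //= mxE def_c eqxx mulr1 big1 ?addr0 // => d.
by rewrite -val_eqE /= def_c mxE => /negPf->; rewrite mulr0.
Qed.

Let last_coord : 'I_k := Ordinal (eq_leq (ltn_predK k_gt1)).

Lemma row_mul_Amx_last (y : V) : (y *m Amx p k) 0 last_coord = 0.
Proof.
rewrite mxE big1 // => c _.
by rewrite mxE /= (ltn_predK k_gt1) (ltn_eqF (ltn_ord c)) mulr0.
Qed.

(** In [y A = b] the shift determines every coordinate of [y] except the first, which is free. *)
Lemma card_Amx_fiber (b : V) :
  #|[set y : V | y *m Amx p k == b]| = if b 0 last_coord == 0 then p else 0%N.
Proof.
case: eqP => [b_last | b_last]; last first.
  apply/eqP; rewrite cards_eq0; apply/eqP/setP=> y; rewrite !inE.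
  by apply/eqP=> def_b; case: b_last; rewrite -def_b row_mul_Amx_last.
pose prev (c : 'I_k) : 'I_k := Ordinal (leq_ltn_trans (leq_pred c) (ltn_ord c)).
(* [f a] is the solution whose first coordinate is [a]. *)
pose f (a : 'F_p) : V := \row_c (if c == 0%N :> nat then a else b 0 (prev c)).
pose c0 : 'I_k := Ordinal (ltnW k_gt1).
have f_inj : injective f.
  by move=> a a' /rowP/(_ c0); rewrite !mxE.
rewrite -[RHS](card_Fp p_pr) -(card_imset _ f_inj); apply: eq_card => y; rewrite inE.
apply/eqP/imsetP=> [def_b | [a _ ->]].
  exists (y 0 c0) => //; apply/rowP=> c; rewrite mxE -def_b.
  have [c_eq0 | c_neq0] := eqVneq (c : nat) 0%N.
    by congr (y 0 _); apply: val_inj.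
  by rewrite (@row_mul_Amx _ _ c) //= prednK // lt0n.
apply/rowP=> j; have [ltjk | lekj] := ltnP j.+1 k.
  rewrite (@row_mul_Amx _ _ (Ordinal ltjk)) // mxE /=.
  by congr (b 0 _); apply: val_inj.
have -> : j = last_coord.
  by apply/val_inj/eqP; rewrite -eqSS /= (ltn_predK k_gt1) eqn_leq ltn_ord.
by rewrite row_mul_Amx_last b_last.
Qed.

(** By [tau_mxE], the twist by [w] of [phi_v B^i] sends the affine point [(1, y)] to the one whose
    vector part is the left-hand side here. *)
Definition twisted_fix (w v : V) i :=
  #|[set y : V | w *m Omega_mx p k i + v *m Bmx p k ^+ i + y *m Bmx p k ^+ i == y]|.

Lemma twisted_fix_dvd w v i : (p %| i)%N -> v != 0 -> twisted_fix w v i = 0%N.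
Proof.
case/dvdnP=> m ->; rewrite mulnC => nz_v; rewrite /twisted_fix.
rewrite Omega_mx_mulp // Bmx_mulp // mulmx0 add0r.
apply/eqP; rewrite cards_eq0; apply/eqP/setP=> y; rewrite !inE !mulmx1.
by rewrite -[RHS](negPf nz_v) -{2}[y]add0r (inj_eq (addIr y)).
Qed.

Lemma twisted_fix_ndvd v i : ~~ (p %| i)%N ->
  exists c : 'F_p, forall r, twisted_fix (w_ k r) v i = if r == c then p else 0%N.
Proof.
move=> p'i; have uO := Omega_mx_unit p_pr p'i.
pose b := v *m Bmx p k ^+ i *m invmx (Omega_mx p k i).
(* Cancelling [Omega_i] on the right leaves [y A = - (w_r + b)], solvable exactly when [r] plus the
   last coordinate of [b] vanishes. *)
exists (- b 0 last_coord) => r.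
have -> : (r == - b 0 last_coord) = ((- (w_ k r + b)) 0 last_coord == 0).
  by rewrite !mxE /= eqxx oppr_eq0 addr_eq0.
rewrite -card_Amx_fiber /twisted_fix; apply: eq_card => y; rewrite !inE.
have -> : w_ k r *m Omega_mx p k i + v *m Bmx p k ^+ i = (w_ k r + b) *m Omega_mx p k i.
  by rewrite mulmxDl mulmxKV.
have -> : y *m Bmx p k ^+ i = y + y *m Amx p k *m Omega_mx p k i.
  by rewrite -mulmxA -Bmx_subr1 mulmxBr mulmx1 addrC subrK.
rewrite addrCA -{3}[y]addr0 (inj_eq (addrI y)) addrC -mulmxDl.
rewrite -[X in _ == X](mul0mx _ (Omega_mx p k i)) (inj_eq (can_inj (mulmxK uO))).
by rewrite addr_eq0.
Qed.

Lemma card_fix_twist w v i :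
  #|[set x | aut_rep (Gbar_rep p k) (twist_autP p_pr k_gt1 k_ltp w)
               (transgl v * Bgl i 0)%g x == x]| = twisted_fix w v i.
Proof.
have Gt := Gbar_mem p_pr k_gt1 k_ltp v i.
have def_t : twist_aut p_pr k_gt1 k_ltp w (transgl v * Bgl i 0)%g =
             Bgl i (w *m Omega_mx p k i + v *m Bmx p k ^+ i).
  by rewrite [LHS]autE // twistE tau_mxE.
have Gg := Aut_closed (twist_autP p_pr k_gt1 k_ltp w) Gt; rewrite def_t in Gg.
rewrite -[RHS](card_fix_affGL Gg); apply: eq_card => x.
by rewrite !inE /aut_rep [X in X == x](congr1 (fun g => Gbar_rep p k g x) def_t).
Qed.

Lemma Gbar_elem t : t \in Gbar p k -> exists v i, t = (transgl v * Bgl i 0)%g.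
Proof.
rewrite -(im_tau0 p_pr k_gt1 k_ltp) => /morphimP[g _ Gg ->].
have [v [i [_ ->]]] := GpermP p_pr k_gt1 k_ltp _ Gg.
by exists v, i; rewrite /= tau_funE // tau_mx0.
Qed.

Lemma twisted_fix_cases t : t \in Gbar p k -> t != 1%g ->
  exists v i, t = (transgl v * Bgl i 0)%g /\
    ((forall w, twisted_fix w v i = 0%N) \/
     (exists c, forall r, twisted_fix (w_ k r) v i = if r == c then p else 0%N)).
Proof.
move=> Gt t_neq1; have [v [i def_t]] := Gbar_elem Gt; exists v, i; split=> //.
have [p_i | /twisted_fix_ndvd] := boolP (p %| i)%N; [left=> w | by right].
(* If [p] divides [i], then [t] is the translation by [v], so [t != 1] gives [v != 0]. *)
apply: twisted_fix_dvd => //; apply: contraNneq t_neq1 => v0; rewrite def_t v0.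
have [m ->] := dvdnP p_i; rewrite mulnC -tau_mx0 tau_mxE !mul0mx addr0 -affGL1.
by apply/eqP; apply: affGL_eq; rewrite ?Bmx_mulp.
Qed.

Lemma Gbar_neq1 v i : ~~ (p %| i)%N -> (transgl v * Bgl i 0)%g != 1%g :> {'GL_k.+1['F_p]}.
Proof.
apply: contraNneq; rewrite -tau_mx0 tau_mxE -affGL1 => /affGL_inj[_].
exact: Bmx_eq1.
Qed.

Lemma moved_affine_twists (r : 'I_p) v i :
  moved (tnth (affine_twists p_pr k_gt1 k_ltp) r) (transgl v * Bgl i 0)%g =
    (p ^ k - twisted_fix (w_ k r%:R) v i)%N.
Proof. by rewrite movedE tnth_mktuple card_fix_twist card_affine_point. Qed.

Let p_gt1 := prime_gt1 p_pr.
Let p_gt0 := prime_gt0 p_pr.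
Let p'1 : ~~ (p %| 1)%N. Proof. by rewrite dvdn1 gtn_eqF. Qed.
Let lt_p_pk : (p < p ^ k)%N. Proof. by rewrite -{1}[p]expn1 ltn_exp2l. Qed.

(** The casts [r%:R] for [r < p] run through ['F_p] once each, so a single term is nonzero. *)
Lemma sum_affine_fix (c : 'F_p) :
  (\sum_(r < p) (if r%:R == c then p else 0) = p)%N.
Proof.
have lt_cp : (c < p)%N by rewrite -[X in (_ < X)%N](Fp_cast p_pr) ltn_ord.
rewrite (bigD1 (Ordinal lt_cp)) //= natr_Zp eqxx big1 ?addn0 // => r.
rewrite -val_eqE /=; apply: contraNeq; case: (_%:R =P c) => [<- _ | //].
by rewrite val_Fp_nat // modn_small.
Qed.

Lemma affine_delta_tw : delta_tw (affine_twists p_pr k_gt1 k_ltp) = (p ^ k.+1 - p)%N.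
Proof.
have sum_moved v i c :
    (forall r, twisted_fix (w_ k r) v i = if r == c then p else 0%N) ->
  (\sum_(r < p) moved (tnth (affine_twists p_pr k_gt1 k_ltp) r)
      (transgl v * Bgl i 0)%g = p ^ k.+1 - p)%N.
  move=> fix_c; under eq_bigr do rewrite moved_affine_twists fix_c.
  rewrite sumnB => [|r _]; last by case: ifP => // _; apply: ltnW.
  by rewrite sum_affine_fix sum_nat_const card_ord expnS.
apply: delta_tw_eq.
- by rewrite subn_gt0 (ltn_trans lt_p_pk) // ltn_exp2l.
- move=> t Gt /(twisted_fix_cases Gt)[v [i [-> [fix0 | [c /sum_moved-> //]]]]].
  under eq_bigr do rewrite moved_affine_twists fix0 subn0.
  by rewrite sum_nat_const card_ord -expnS leq_subr.
exists (transgl 0 * Bgl 1 0)%g; split; rewrite ?Gbar_mem ?Gbar_neq1 //.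
by have [c] := twisted_fix_ndvd 0 p'1; apply: sum_moved.
Qed.

Lemma affine_delta_rep :
  delta_rep (affine_twists p_pr k_gt1 k_ltp) = (p ^ k.+1 - p ^ 2)%N.
Proof.
rewrite expnS -mulnBr; apply: delta_rep_eq => // [|r t Gt | r].
- by rewrite subn_gt0.
- case/(twisted_fix_cases Gt)=> v [i [-> fix_t]].
  rewrite moved_affine_twists leq_sub2l //.
  by case: fix_t => [-> // | [c ->]]; case: ifP.
(* This [v] cancels the translation part [w Omega_1 + v B], where [Omega_1 = 1]. The twist then
   fixes [0], so its number of fixed points, [0] or [p], is [p]. *)
pose w : V := w_ k r%:R; pose v := - w *m invmx (Bmx p k ^+ 1).
exists (transgl v * Bgl 1 0)%g; split; rewrite ?Gbar_mem ?Gbar_neq1 //.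
rewrite moved_affine_twists; congr (_ - _)%N.
have [c fix_c] := twisted_fix_ndvd v p'1; have := fix_c r%:R; case: ifP => // _.
move/eqP; rewrite cards_eq0 => /eqP/setP/(_ 0); rewrite !inE /Omega_mx big_ord1.
by rewrite mulmx1 mulmxKV ?Bmx_unit // subrr mul0mx addr0 eqxx.
Qed.

End AffineFixedPoints.

(** * Counting fixed projective points by eigenspaces *)

Section SymplecticFixedPoints.

Variables (F : finFieldType) (q : nat) (cardF : #|F| = q).
Variable form : {skew_symmetric 'rV[F]_4}.
Implicit Types (g : {'GL_4[F]}) (a : F) (u v z : 'rV[F]_4) (L : PG F).

Let q_gt1 : (1 < q)%N. Proof. by rewrite -cardF card_finNzRing_gt1. Qed.

Definition pg_line v (nz_v : v != 0) : PG F.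
Proof.
exists [set a *: v | a : F]; apply/existsP; exists v.
by rewrite nz_v eqxx.
Defined.

Lemma mem_pg_line L v (nz_v : v != 0) : (v \in val L) = (L == pg_line nz_v).
Proof.
apply/idP/eqP=> [|->]; last by apply/imsetP; exists 1; rewrite ?scale1r.
case: L => L /= L_pg Lv; apply: val_inj => /=.
have /existsP[u /andP[nz_u /eqP def_L]] := L_pg.
move: Lv; rewrite def_L => /imsetP[b _ def_v].
have nz_b : b != 0 by apply: contraNneq nz_v => b0; rewrite def_v b0 scale0r.
apply/setP=> x; apply/imsetP/imsetP=> [[a _ ->] | [a _ ->]].
  by exists (a / b); rewrite // def_v scalerA divfK.
by exists (a * b); rewrite // def_v scalerA.
Qed.

Lemma card_pg_point L : #|[set v in val L | v != 0]| = q.-1.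
Proof.
case: L => L /= /existsP[u /andP[nz_u /eqP->]].
have inj_u : injective (fun a => a *: u).
  move=> a b /eqP; rewrite -subr_eq0 -scalerBl scaler_eq0 (negPf nz_u) orbF subr_eq0.
  by move/eqP.
rewrite -cardF -(cardsC1 (0 : F)) -(card_imset _ inj_u); apply: eq_card => v.
rewrite !inE; apply/andP/imsetP=> [[/imsetP[a _ ->]] | [a]].
  by rewrite scaler_eq0 negb_or => /andP[nz_a _]; exists a; rewrite ?inE.
rewrite !inE => nz_a ->; rewrite scaler_eq0 negb_or nz_a; split=> //.
exact: imset_f.
Qed.

Lemma pg_fixed_line g v (nz_v : v != 0) : g \in Sp form ->
  (pg_line nz_v \in pg_fixed form g) = (v *m GLval g <= v)%MS.
Proof.
move=> Sg; have nz_vg : v *m GLval g != 0.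
  apply: contra nz_v => /eqP/(congr1 (mulmxr (invmx (GLval g)))) /=.
  by rewrite mul0mx (mulmxK (GL_unitmx g)) => ->.
rewrite inE; have -> : Sp_rep form g (pg_line nz_v) = pg_line nz_vg.
  apply/eqP; rewrite -mem_pg_line Sp_repE //; apply/imsetP; exists v => //.
  by rewrite mem_pg_line.
rewrite eq_sym -mem_pg_line; apply/imsetP/sub_rVP=> [[a _ ->] | [a ->]]; by exists a.
Qed.

Lemma card_eigenvectors (A : 'M[F]_4) a :
  (\sum_(v : 'rV[F]_4 | v != 0%R) (v <= eigenspace A a)%MS = (q ^ \rank (eigenspace A a)).-1)%N.
Proof.
rewrite -cardF -card_rowg (cardD1 0) mem_rowg sub0mx -sum1_card [RHS]/=.
rewrite [RHS](eq_bigl (fun v => (v != 0) && (v <= eigenspace A a)%MS)) => [|v].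
  by rewrite big_mkcondr; apply: eq_bigr => v _; case: ifP.
by rewrite !inE.
Qed.

(** Double counting of the nonzero vectors on fixed points: each point carries [q - 1] of them, and
    each is an eigenvector for exactly one eigenvalue. *)
Lemma card_pg_fixed g : g \in Sp form ->
  (#|pg_fixed form g| * q.-1 = \sum_a (q ^ \rank (eigenspace (GLval g) a)).-1)%N.
Proof.
move=> Sg; under [RHS]eq_bigr do rewrite -card_eigenvectors.
rewrite exchange_big -sum_nat_const /=.
under eq_bigr => L _ do rewrite -(card_pg_point L) -sum1_card.
under eq_bigr => L _ do under eq_bigl => v do rewrite inE andbC.
rewrite (exchange_big_dep (fun v => v != 0)) /= => [|L v _ /andP[] //].
apply: eq_bigr => v nz_v.
transitivity (pg_line nz_v \in pg_fixed form g : nat).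
  rewrite (eq_bigl (fun L => (L == pg_line nz_v) && (L \in pg_fixed form g))) => [|L].
    rewrite big_mkcondr big_pred1_eq; by case: ifP.
  by rewrite nz_v mem_pg_line andbC.
rewrite pg_fixed_line //; case: sub_rVP => [[a def_vg] | no_a].
  rewrite (bigD1 a) //=; have -> : (v <= eigenspace (GLval g) a)%MS by apply/eigenspaceP.
  rewrite big1 ?addn0 // => b neq_ba; case: eigenspaceP => //; rewrite def_vg => /eqP.
  by rewrite -subr_eq0 -scalerBl scaler_eq0 subr_eq0 eq_sym (negPf neq_ba) (negPf nz_v).
by rewrite big1 // => a _; case: eigenspaceP => // def_vg; case: no_a; exists a.
Qed.

(** Division by [q - 1] turns each [q^d - 1] into a geometric sum. *)
Lemma card_pg_fixed_eq g : g \in Sp form ->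
  (#|pg_fixed form g| = \sum_a \sum_(i < \rank (eigenspace (GLval g) a)) q ^ i)%N.
Proof.
move=> Sg; have q1_gt0 : (0 < q.-1)%N by rewrite -subn1 subn_gt0.
apply/eqP; rewrite -(eqn_pmul2r q1_gt0) card_pg_fixed // big_distrl /=; apply/eqP.
by apply: eq_bigr => a _; rewrite predn_exp mulnC.
Qed.

Lemma sum_mxrank_eigenspace (A : 'M[F]_4) : (\sum_a \rank (eigenspace A a) <= 4)%N.
Proof.
have /mxdirectP/= <- := mxdirect_sum_eigenspace A (in2W (@inj_id F)) (P := xpredT).
exact: rank_leq_col.
Qed.

(** On the eigenspace of [a], [(A - 1)^2] acts as the scalar [(a - 1)^2]. *)
Lemma eigenspace_unipotent (A : 'M[F]_4) a :
  (A - 1) ^+ 2 = 0 -> a != 1 -> eigenspace A a = 0.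
Proof.
move=> A1_0 neq_a1; set W := eigenspace A a.
have WA1 : W *m (A - 1) = (a - 1) *: W.
  by rewrite mulmxBr mulmx1 scalerBl scale1r; congr (_ - _); apply/eigenspaceP.
have : W *m ((A - 1) *m (A - 1)) = 0 by rewrite -[(A - 1) *m _]/((A - 1) ^+ 2) A1_0 mulmx0.
rewrite mulmxA WA1 -scalemxAl WA1 scalerA => /eqP.
by rewrite scaler_eq0 mulf_eq0 subr_eq0 (negPf neq_a1) => /eqP.
Qed.

Lemma card_pg_fixed_unipotent g : g \in Sp form -> (GLval g - 1) ^+ 2 = 0 ->
  (#|pg_fixed form g| = \sum_(i < 4 - \rank (GLval g - 1)%R) q ^ i)%N.
Proof.
move=> Sg g1_0; rewrite card_pg_fixed_eq // (bigD1 1) //= [X in (_ + X)%N]big1 => [|a].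
  by rewrite addn0 /eigenspace mxrank_ker.
by move=> neq_a1; rewrite eigenspace_unipotent // mxrank0 big_ord0.
Qed.

(** The identity fixes every point, so the unipotent count applies with rank [0]. *)
Lemma card_PG : (#|{: PG F}| = q ^ 3 + q ^ 2 + q + 1)%N.
Proof.
have [e [Se e_mx]] : exists e, e \in Sp form /\ GLval e = 1.
  by exists (1%g : {'GL_4[F]}); split; rewrite ?group1.
have := card_pg_fixed_unipotent Se.
rewrite e_mx subrr expr0n mxrank0 !big_ord_recr big_ord0 /= => /(_ erefl) def_f.
transitivity #|pg_fixed form e|; last by rewrite def_f; lia.
rewrite -cardsT; congr #|pred_of_set _|; apply/setP=> L; rewrite !inE -val_eqE Sp_repE //.
by rewrite e_mx (eq_imset _ (@mulmx1 _ _ _)) imset_id eqxx.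
Qed.

Lemma card_pg_fixed_transvection g : g \in Sp form -> is_transvection g ->
  (#|pg_fixed form g| = q ^ 2 + q + 1)%N.
Proof.
move=> Sg /andP[/eqP rk_g /eqP g1_0]; rewrite card_pg_fixed_unipotent // rk_g.
by rewrite !big_ord_recr big_ord0 /= ?expn0 ?expn1; lia.
Qed.

(** Here [g - 1] has rank at least [2], so the fixed space of [g] has dimension at most [2]. *)
Lemma card_pg_fixed_unipotent_leq g : g \in Sp form -> (GLval g - 1) ^+ 2 = 0 ->
  g != 1%g -> ~~ is_transvection g -> (#|pg_fixed form g| <= q + 1)%N.
Proof.
move=> Sg g1_0 g_neq1 g_ntv; rewrite card_pg_fixed_unipotent //.
have rk_neq1 : \rank (GLval g - 1)%R != 1%N.
  by apply: contra g_ntv; rewrite /is_transvection g1_0 eqxx => ->.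
have rk_neq0 : \rank (GLval g - 1)%R != 0%N.
  rewrite mxrank_eq0 subr_eq0; apply: contra g_neq1 => /eqP g1.
  by apply/eqP/val_inj.
have: (4 - \rank (GLval g - 1)%R <= 2)%N by lia.
case: (4 - _)%N => [|[|[|d]]] // _; rewrite ?big_ord_recr big_ord0 /= ?expn0 ?expn1; lia.
Qed.

(** * Isometries of a symplectic form in characteristic 2 *)

Hypotheses (formS : is_psymplectic form) (char2 : 2 \in [pchar F]).

Local Notation M := (matrix_of_form form).

Lemma form_mxE u v : form u v = (u *m M *m v^T) 0 0.
Proof.
rewrite -(matrix_of_formK form) /form_of_matrix /mxtrace big_ord1; congr ((_ *m _) _ _).
by apply/matrixP=> i j; rewrite !mxE.
Qed.

Lemma form_mx_unit : M \in unitmx.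
Proof.
rewrite -row_free_unit; apply/row_freeP; apply/row_freeP/inj_row_free => v vM0.
have [/eqP radv _ _] := formS; apply/eqP; rewrite -memv0 -radv.
by apply/mem_orthovP=> u _; rewrite form_mxE vM0 mul0mx mxE.
Qed.

(** Skew-symmetry does not imply this in characteristic [2]; it is the last clause of
    [is_psymplectic]. *)
Lemma form_mx_alt z : z *m M *m z^T = 0.
Proof.
have [_ _ /(_ char2) alt] := formS.
by apply/rowP=> i; rewrite !ord1 -form_mxE alt mxE.
Qed.

(** As [M] is invertible, [W M] and [W^T] both have the rank of [W]; their product being zero, twice
    that rank is at most [4]. *)
Lemma isotropic_rank m (W : 'M[F]_(m, 4)) : W *m M *m W^T = 0 -> (\rank W <= 2)%N.
Proof.
move/mulmx0_rank_max; rewrite mxrankMfree ?row_free_unit ?form_mx_unit // mxrank_tr.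
lia.
Qed.

Lemma Sp_mxP g : reflect (GLval g *m M *m (GLval g)^T = M) (g \in Sp form).
Proof.
apply: (iffP (Sp_setP _ _)) => [Sg | gM u v]; last first.
  by rewrite !form_mxE trmx_mul !mulmxA -[u *m _ *m M *m _]mulmxA -[in RHS]gM !mulmxA.
pose e i : 'rV[F]_4 := delta_mx 0 i.
have entryE (N : 'M[F]_4) i j : (e i *m N *m (e j)^T) 0 0 = N i j.
  by rewrite -rowE trmx_delta -colE !mxE.
apply/matrixP=> i j; have := Sg (e i) (e j).
by rewrite !form_mxE trmx_mul !mulmxA entryE => <-; rewrite -entryE !mulmxA.
Qed.

Lemma eigenspace_rank_gt2 g a : g \in Sp form ->
  (2 < \rank (eigenspace (GLval g) a))%N -> a = 1.
Proof.
move=> /Sp_mxP gM; set W := eigenspace _ a => rkW.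
have Wg : W *m GLval g = a *: W by apply/eigenspaceP.
(* Applying [g] multiplies the Gram matrix of [W] by [a^2], yet an isometry preserves it. *)
have WMW : a ^+ 2 *: (W *m M *m W^T) = W *m M *m W^T.
  rewrite -{2}gM !mulmxA Wg -[_ *m (GLval g)^T *m _]mulmxA -trmx_mul Wg linearZ /=.
  by rewrite -!scalemxAl -scalemxAr scalerA.
have /eqP nzWMW : W *m M *m W^T <> 0 by move/isotropic_rank; rewrite leqNgt rkW.
move/eqP: WMW; rewrite -subr_eq0 -{2}[W *m M *m _]scale1r -scalerBl scaler_eq0.
by rewrite (negPf nzWMW) orbF subr_eq0 sqrf_eq1 (oppr_pchar2 char2) orbb => /eqP.
Qed.

Lemma Sp_rank1_transvection g : g \in Sp form ->
  \rank (GLval g - 1)%R = 1%N -> is_transvection g.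
Proof.
move=> /Sp_mxP gM rk1; rewrite /is_transvection rk1 eqxx /=.
set N := GLval g - 1 in rk1 *.
(* A rank one [N] is [c *m z], and [form z z = 0]. *)
have alt : N *m M *m N^T = 0.
  have [c [z ->]] : exists (c : 'cV[F]_4) z, N = c *m z.
    rewrite -(mulmx_base N); move: (col_base N) (row_base N); rewrite rk1 => c z.
    by exists c, z.
  by rewrite trmx_mul !mulmxA -!(mulmxA c) form_mx_alt mul0mx mulmx0.
have def_g : GLval g = 1 + N by rewrite addrC subrK.
(* The isometry condition on [1 + N], its quadratic term being zero. Multiplied by [N] on the left,
   it leaves [N^2 M = 0]. *)
clearbody N; have NM : N *m M + M *m N^T = 0.
  move: gM; rewrite def_g linearD /= trmx1 !mulmxDl !mulmxDr !mul1mx !mulmx1 alt addr0.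
  by rewrite -addrA => /(canRL (addKr _)); rewrite addNr addrC.
have : N *m N *m M = 0.
  have := congr1 (mulmx N) NM; rewrite mulmx0 mulmxDr !mulmxA alt addr0; exact.
move/(congr1 (mulmxr (invmx M))); rewrite /= mul0mx mulmxK ?form_mx_unit // => NN.
by apply/eqP.
Qed.

(** A larger eigenspace would be the kernel of [g - 1], which would then have rank [1]. *)
Lemma eigenspace_rank_leq2 g a : g \in Sp form -> g != 1%g -> ~~ is_transvection g ->
  (\rank (eigenspace (GLval g) a) <= 2)%N.
Proof.
move=> Sg g_neq1 g_ntv; rewrite leqNgt; apply: contra g_ntv => rk_gt2.
apply: Sp_rank1_transvection => //.
have rk_g : \rank (eigenspace (GLval g) a) = (4 - \rank (GLval g - 1)%R)%N.
  by rewrite (eigenspace_rank_gt2 Sg rk_gt2) /eigenspace mxrank_ker.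
have rk_neq0 : \rank (GLval g - 1)%R != 0%N.
  rewrite mxrank_eq0 subr_eq0; apply: contra g_neq1 => /eqP g1.
  by apply/eqP/val_inj.
by lia.
Qed.

(** The first bound comes from the total dimension [4] of the eigenspaces, the second from the
    number of eigenvalues; the second serves when [q = 2]. *)
Lemma card_pg_fixed_leq g : g \in Sp form -> g != 1%g -> ~~ is_transvection g ->
  (#|pg_fixed form g| <= minn (2 * (q + 1)) (q.-1 * (q + 1)))%N.
Proof.
move=> Sg g_neq1 g_ntv; rewrite card_pg_fixed_eq //.
have rk2 a := eigenspace_rank_leq2 a Sg g_neq1 g_ntv.
have lt1q := q_gt1.
rewrite leq_min; apply/andP; split.
  (* For [d <= 2], twice the number of points of a [d]-dimensional space is at most [d (q + 1)]. *)
  rewrite -(leq_pmul2l (isT : 0 < 2)%N) mulnA.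
  apply: leq_trans (leq_mul (sum_mxrank_eigenspace (GLval g)) (leqnn (q + 1))).
  rewrite big_distrr big_distrl /=; apply: leq_sum => a _.
  case: (\rank _) (rk2 a) => [|[|[|d]]] // _;
    by rewrite ?big_ord_recr big_ord0 /= ?expn0 ?expn1; lia.
(* Invertibility of [g] excludes the eigenvalue [0]. *)
rewrite (bigD1 0) //= /eigenspace mxrank_ker raddf0 subr0.
rewrite mxrank_unit; last exact: (GL_unitmx g).
rewrite big_ord0 add0n -cardF -(cardC1 (0 : F)) -sum_nat_const; apply: leq_sum => a _.
case: (\rank _) (rk2 a) => [|[|[|d]]] // _;
  by rewrite ?big_ord_recr big_ord0 /= ?expn0 ?expn1; lia.
Qed.

Lemma form_mx_tr : M^T = - M.
Proof. by apply/matrixP=> i j; rewrite !mxE hermC expr1 mulN1r. Qed.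

(* The witness is [u |-> u + form u z z]. *)
Lemma exists_transvection : exists2 g, g \in Sp form & is_transvection g.
Proof.
pose z : 'rV[F]_4 := delta_mx 0 0; pose c := M *m z^T; pose N : 'M[F]_4 := c *m z.
have zc : z *m c = 0 by rewrite mulmxA form_mx_alt.
have NN : N *m N = 0 by rewrite mulmxA -(mulmxA c) zc mulmx0 mul0mx.
have uT : 1 + N \in unitmx.
  suff: (1 + N) *m (1 - N) = 1%:M by case/mulmx1_unit.
  by rewrite mulmxDl mul1mx mulmxBr mulmx1 NN subr0 subrK.
pose g : {'GL_4[F]} := FinRing.unit _ (uT : 1 + N \is a GRing.unit).
have def_g : GLval g = 1 + N by [].
exists g; last first.
  rewrite /is_transvection def_g addrC addKr -[N ^+ 2]/(N *m N) NN eqxx andbT.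
  rewrite eqn_leq (leq_trans (mxrankM_maxr c z)) ?rank_leq_row //= lt0n mxrank_eq0.
  (* Since [z z^T = 1], [N = 0] would give [M z^T = 0] with [M] invertible and [z] nonzero. *)
  apply/eqP=> N0; have : N *m z^T = c.
    by rewrite -mulmxA trmx_delta mul_delta_mx -[c in RHS]mulmx1; congr (_ *m _);
      apply/rowP=> i; rewrite !ord1 !mxE.
  rewrite N0 mul0mx => /esym/(congr1 (mulmx (invmx M))).
  rewrite mulmx0 mulKmx ?form_mx_unit // => /colP/(_ 0)/eqP.
  by rewrite !mxE oner_eq0.
apply/Sp_mxP; rewrite def_g linearD /= trmx1 !mulmxDl !mulmxDr !mul1mx !mulmx1.
have -> : N *m M *m N^T = 0.
  by rewrite trmx_mul !mulmxA -!(mulmxA c) form_mx_alt mul0mx mulmx0.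
rewrite addr0 -addrA -[RHS]addr0; congr (_ + _).
by rewrite !trmx_mul trmxK form_mx_tr !mulmxA mulmxN addNr.
Qed.

(** In characteristic [2], [(g - 1)^2 = g^2 - 1]. The right-hand condition involves only the group
    law, so automorphisms preserve it. *)
Lemma unipotent_involution g : ((GLval g - 1) ^+ 2 == 0) = (g * g == 1)%g.
Proof.
have char2M : 2 \in [pchar 'M[F]_4] by rewrite pchar_lalg.
rewrite sqrrB1 (mulrn_pchar char2M) subr0 addr_eq0 (oppr_pchar2 char2M).
apply/eqP/eqP=> [g2 | /(congr1 val)/= //].
by apply: val_inj.
Qed.

Lemma card_pg_fixed_neq1 g : g \in Sp form -> g != 1%g ->
  (#|pg_fixed form g| <= q ^ 2 + q + 1)%N.
Proof.
move=> Sg g_neq1; have [g_tv | g_ntv] := boolP (is_transvection g).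
  by rewrite card_pg_fixed_transvection.
have := card_pg_fixed_leq Sg g_neq1 g_ntv; have lt1q := q_gt1.
rewrite leq_min => /andP[_ /leq_trans-> //]; nia.
Qed.

Lemma moved_Sp_rep (s : {perm {'GL_4[F]}}) (As : s \in Aut (Sp form)) t g :
  s t = g ->
  (moved (aut_rep (Sp_rep form) As) t = q ^ 3 + q ^ 2 + q + 1 - #|pg_fixed form g|)%N.
Proof. by move=> <-; rewrite movedE card_PG. Qed.

(** * Points moved under an arbitrary automorphism *)

Section SymplecticAutomorphism.

Variables (tau : {perm {'GL_4[F]}}) (Atau : tau \in Aut (Sp form)).

Lemma Aut_eq1 t : (tau t == 1%g) = (t == 1%g).
Proof.
have tau1 : tau 1%g = 1%g.
  apply: (mulgI (tau 1%g)).
  by rewrite -(morphicP (Aut_morphic Atau)) ?group1 // !mulg1.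
by rewrite -{1}tau1 (inj_eq perm_inj).
Qed.

Lemma moved_Sp_rep_geq t : t \in Sp form -> t != 1%g ->
  (q ^ 3 <= moved (aut_rep (Sp_rep form) Atau) t)%N.
Proof.
move=> St t_neq1; rewrite (moved_Sp_rep _ erefl); rewrite -Aut_eq1 in t_neq1.
by move: (card_pg_fixed_neq1 (Aut_closed Atau St) t_neq1); set f := #|_|; lia.
Qed.

Lemma moved_Sp_rep_attained :
  exists t, [/\ t \in Sp form, t != 1%g & moved (aut_rep (Sp_rep form) Atau) t = q ^ 3]%N.
Proof.
have [g Sg g_tv] := exists_transvection.
have tau_g : tau ((tau^-1)%g g) = g by rewrite permKV.
have St : (tau^-1)%g g \in Sp form by rewrite Aut_closed ?groupV.
(* The preimage of a transvection is twisted by [tau] into an element with [q^2 + q + 1] fixed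
   points. *)
exists ((tau^-1)%g g); split=> //.
  apply: contraTneq g_tv => /eqP; rewrite -Aut_eq1 tau_g => /eqP->.
  by rewrite /is_transvection subrr mxrank0.
rewrite (moved_Sp_rep _ tau_g) card_pg_fixed_transvection //; lia.
Qed.

End SymplecticAutomorphism.

(** * The twist by [tau] and the distances of part (b) *)

Section OuterTwist.

Variables (tau : {perm {'GL_4[F]}}) (Atau : tau \in Aut (Sp form)).
Hypothesis tau_transv : forall t, t \in Sp form -> is_transvection t ->
  #|pg_fixed form (tau t)| = (q + 1)%N.

(** The bound is [(q^2 + q + 1) + (q + 1)], the value at transvections. *)
Lemma card_pg_fixed_twist t : t \in Sp form -> t != 1%g ->
  (#|pg_fixed form t| + #|pg_fixed form (tau t)| <= q ^ 2 + 2 * q + 2)%N.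
Proof.
move=> St t_neq1; have Sut := Aut_closed Atau St; have lt1q := q_gt1.
have [t_tv | t_ntv] := boolP (is_transvection t).
  have le_t := eq_leq (card_pg_fixed_transvection St t_tv).
  by apply: leq_trans (leq_add le_t (eq_leq (tau_transv St t_tv))) _; clear; lia.
have [ut_tv | ut_ntv] := boolP (is_transvection (tau t)).
  have t2 : (t * t == 1)%g.
    rewrite -(Aut_eq1 Atau) (morphicP (Aut_morphic Atau)) // -unipotent_involution.
    by case/andP: ut_tv.
  rewrite -unipotent_involution in t2.
  have le_t := card_pg_fixed_unipotent_leq St (eqP t2) t_neq1 t_ntv.
  have le_ut := eq_leq (card_pg_fixed_transvection Sut ut_tv).
  by apply: leq_trans (leq_add le_t le_ut) _; clear; lia.
have le_t := card_pg_fixed_leq St t_neq1 t_ntv; rewrite -(Aut_eq1 Atau) in t_neq1.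
have le_ut := card_pg_fixed_leq Sut t_neq1 ut_ntv.
apply: leq_trans (leq_add le_t le_ut) _; clear -lt1q.
(* [4 (q + 1)] is at most [q^2 + 2 q + 2] only from [q = 3] on; for [q = 2] the bound
   [(q - 1) (q + 1) = 3] on each term suffices. *)
have [->|q_neq2] := eqVneq q 2%N; [by [] | nia].
Qed.

Let twists := symplectic_twists Atau.

Lemma sum_moved_twists t : (\sum_(i < 2) moved (tnth twists i) t =
    (q ^ 3 + q ^ 2 + q + 1 - #|pg_fixed form t|) +
    (q ^ 3 + q ^ 2 + q + 1 - #|pg_fixed form (tau t)|))%N.
Proof.
have moved1 := moved_Sp_rep (group1 [group of Aut (Sp form)]) (perm1 t).
have moved_tau := moved_Sp_rep Atau (erefl (tau t)).
exact: etrans (sum_tnth2 _ _ (fun rho => moved rho t)) (congr2 addn moved1 moved_tau).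
Qed.

Lemma symplectic_delta_tw : delta_tw twists = (2 * q ^ 3 + q ^ 2)%N.
Proof.
have lt1q := q_gt1; apply: delta_tw_eq => [|t St t_neq1|].
- by rewrite addn_gt0 !expn_gt0 orbC ltnW.
- have arith f1 f2 : (f1 + f2 <= q ^ 2 + 2 * q + 2 -> 2 * q ^ 3 + q ^ 2 <=
    (q ^ 3 + q ^ 2 + q + 1 - f1) + (q ^ 3 + q ^ 2 + q + 1 - f2))%N by clear; lia.
  by rewrite sum_moved_twists arith ?card_pg_fixed_twist.
have [g Sg g_tv] := exists_transvection; exists g; split=> //.
  by apply: contraTneq g_tv => ->; rewrite /is_transvection subrr mxrank0.
have arith f1 f2 : (f1 = q ^ 2 + q + 1 -> f2 = q + 1 ->
  (q ^ 3 + q ^ 2 + q + 1 - f1) + (q ^ 3 + q ^ 2 + q + 1 - f2) = 2 * q ^ 3 + q ^ 2)%N.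
  by clear => -> ->; lia.
rewrite sum_moved_twists; apply: arith; last exact: tau_transv.
exact: card_pg_fixed_transvection.
Qed.

(** Automorphisms permute the nontrivial elements of [Sp], so both entries have the same least
    number [q^3] of moved points. *)
Lemma symplectic_delta_rep : delta_rep twists = (2 * q ^ 3)%N.
Proof.
have lt1q := q_gt1.
have twistsE i : exists (s : {perm {'GL_4[F]}}) (As : s \in Aut (Sp form)),
    tnth twists i = aut_rep (Sp_rep form) As.
  case: i => [[|[|//]]] lti; first by exists 1%g, (group1 _).
  by exists tau, Atau.
apply: delta_rep_eq => [//||i t St t_neq1|i].
- by rewrite expn_gt0 ltnW.
- by have [s [As ->]] := twistsE i; apply: (moved_Sp_rep_geq As St t_neq1).
have [s [As ->]] := twistsE i.
exact: moved_Sp_rep_attained.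
Qed.

End OuterTwist.

End SymplecticFixedPoints.

Theorem theorem1p1 :
  (forall (p k : nat) (p_pr : prime p) (p_odd : odd p)
          (k_gt1 : (1 < k)%N) (k_ltp : (k < p)%N),
     let I := affine_twists p_pr k_gt1 k_ltp in
     [/\ (delta_rep I < delta_tw I)%N,
         delta_tw I = (p ^ k.+1 - p)%N
       & (delta_tw I - delta_rep I)%N = (p ^ 2 - p)%N])
  /\
  (forall (n : nat) (n_gt0 : (0 < n)%N) (F : finFieldType) (cardF : #|F| = (2 ^ n)%N)
          (form : {skew_symmetric 'rV[F]_4}) (form_sympl : is_psymplectic form)
          (tau : {perm {'GL_4[F]}}) (Atau : tau \in Aut (Sp form))
          (tau_outer : tau \notin Inn (Sp form))
          (tau_transv : forall t : {'GL_4[F]}, t \in Sp form -> is_transvection t ->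
             #|pg_fixed form (tau t)| = (2 ^ n + 1)%N),
     let I := symplectic_twists Atau in
     [/\ (delta_rep I < delta_tw I)%N,
         delta_tw I = (2 ^ (3 * n + 1) + 2 ^ (2 * n))%N
       & (delta_tw I - delta_rep I)%N = (2 ^ (2 * n))%N]).
Proof.
split=> [p k p_pr _ k_gt1 k_ltp I | n n_gt0 F cardF form formS tau Atau _ tau_transv I].
  (* These inequalities keep the truncated subtractions exact. *)
  have le2 : (p ^ 2 <= p ^ k.+1)%N by apply: leq_pexp2l; [apply: prime_gt0 | apply: ltnW].
  have lt1 : (p < p ^ 2)%N by rewrite -{1}[p]expn1 ltn_exp2l ?prime_gt1.
  rewrite affine_delta_tw affine_delta_rep; split=> //.
    by rewrite ltn_sub2l // (leq_trans lt1).
  by clear -le2 lt1; lia.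
have char2 := card_finPcharP cardF isT.
rewrite (symplectic_delta_tw cardF formS char2 Atau tau_transv).
rewrite (symplectic_delta_rep cardF formS char2 Atau).
have -> : (2 ^ (3 * n + 1) = 2 * (2 ^ n) ^ 3)%N by rewrite -expnM mulnC addn1 expnS mulnC.
have -> : (2 ^ (2 * n) = (2 ^ n) ^ 2)%N by rewrite -expnM mulnC.
have q2_gt0 : (0 < (2 ^ n) ^ 2)%N by rewrite !expn_gt0.
by split; rewrite // ?addKn // -[ltnLHS]addn0 ltn_add2l.
Qed.
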